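(* Let $C = (m\mathbb{N} + A) \cup B \cup F$ be an eventually periodic set of period $m$. If $C$ arises as a minimal additive complement in $\mathbb{Z}$, then there exist $Y_+, Y_-, Y_0\subseteq \mathbb{Z}/m\mathbb{Z}$ such that, with $\overline{Y} = Y_+ \cup Y_- \cup Y_0$, (1) $\left(A_{(m)} + \overline{Y}\right) \cup \left(F_{(m)} + Y_+\right) = (A_{(m)} \cup F_{(m)}) + Y_- = \mathbb{Z}/m\mathbb{Z}$; (2) for each $a \in A_{(m)}$, there exists $y_a \in Y_0$ such that $$a + y_a \in (F_{(m)} + Y_-) \setminus \Big(\big((A_{(m)}\setminus \{a\}) + Y_0\big) \cup \big(A_{(m)} + (Y_- \cup Y_+)\big)\Big);$$ (3) for each $f \in F_{(m)}$, there exists $y \in \overline{Y}$ such that $f + y \notin A_{(m)} + Y_-$.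
   Context: $\mathbb{N}=\{1,2,3,\dots\}$. For $S\subseteq\mathbb{Z}$, $S_{(m)}$ denotes the image of $S$ in $\mathbb{Z}/m\mathbb{Z}$ under the standard projection. Sums of sets are Minkowski sums. $C\subseteq\mathbb{Z}$ arises as a minimal additive complement if there is $W\subseteq\mathbb{Z}$ with $C+W=\mathbb{Z}$ and $C'+W\neq\mathbb{Z}$ for every proper subset $C'\subsetneq C$. An eventually periodic set of period $m$ is a set of integers of the form $(m\mathbb{N}+A)\cup B\cup F$, where $A$ is nonempty, $B$ and $F$ are finite, $B_{(m)}\subseteq A_{(m)}$ and $F_{(m)}\cap A_{(m)}=\emptyset$. It is assumed throughout that the representation is normalized so that $(m,A,B,F)$ is unique: $m$ is the minimal period, $A$ has at most one element in each residue class modulo $m$, and $b\notin A+m\mathbb{Z}_{\ge 0}$ for every $b\in B$. *)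

(* Defs.v *)
From HB Require Import structures.
From mathcomp Require Import all_boot all_order all_algebra.
From mathcomp Require Import boolp classical_sets functions cardinality.
Set Implicit Arguments.
Unset Strict Implicit.
Unset Printing Implicit Defensive.
Import Order.TTheory GRing.Theory Num.Theory.
Local Open Scope classical_set_scope.
Local Open Scope ring_scope.

Reserved Notation "X +s Y" (at level 50, left associativity).

Definition minkowski (G : zmodType) (X Y : set G) : set G :=
  [set x + y | x in X & y in Y].
Notation "X +s Y" := (minkowski X Y) : classical_set_scope.

(* The additive group Z/mZ for every m > 0; MathComp's 'Z_m is not usable here
   because 'Z_1 has two elements, whereas the period m = 1 is allowed. *)
Notation Zmod m := 'I_m.-1.+1.

(* The standard projection: the class of z is represented by the remainder of
   z in {0, ..., m - 1}. *)
Definition proj (m : nat) (z : int) : Zmod m := inZp `|(z %% m%:Z)%Z|%N.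

Definition red (m : nat) (S : set int) : set (Zmod m) := proj m @` S.
Arguments red m S : clear implicits.

Lemma projP (m : nat) (z w : int) : (0 < m)%N ->
  proj m z = proj m w <-> (z = w %[mod m%:Z])%Z.
Proof.
case: m => // n _; rewrite /proj.
have ge0 (x : int) : (0 <= x %% n.+1%:Z)%Z by rewrite modz_ge0.
have lt (x : int) : (`|(x %% n.+1%:Z)%Z| < n.+1)%N.
  by rewrite -ltz_nat gez0_abs // ltz_pmod.
split=> [/(congr1 val) /=|-> //].
by rewrite !modn_small // => e; rewrite -(gez0_abs (ge0 z)) e gez0_abs.
Qed.

Lemma projD (m : nat) (z w : int) : (0 < m)%N ->
  proj m (z + w) = proj m z + proj m w.
Proof.
case: m => // n _; apply: val_inj => /=; rewrite !modnDm.
have ge0 (x : int) : (0 <= x %% n.+1%:Z)%Z by rewrite modz_ge0.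
apply/eqP; rewrite -eqz_nat -!modz_nat PoszD !gez0_abs //.
by rewrite modz_mod modzDm.
Qed.

(* The set (m N + A) `|` B `|` F, with N = {1, 2, ...}. *)
Definition epset (m : nat) (A B F : set int) : set int :=
  ([set m%:Z * k | k in [set k : int | 0 < k]] +s A) `|` B `|` F.

Record ep_rep (m : nat) (A B F : set int) : Prop := EpRep {
  ep_m_gt0 : (0 < m)%N;
  ep_A_neq0 : A !=set0;
  ep_B_fin : finite_set B;
  ep_F_fin : finite_set F;
  ep_BA : red m B `<=` red m A;
  ep_FA : red m F `&` red m A = set0 }.

Record normalized_ep_rep (m : nat) (A B F : set int) : Prop := NormEpRep {
  nep_rep : ep_rep m A B F;
  nep_min_period : forall (m' : nat) (A' B' F' : set int),
    ep_rep m' A' B' F' -> epset m' A' B' F' = epset m A B F -> (m <= m')%N;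
  nep_A_inj : {in A &, injective (proj m)};
  nep_BA_disj : forall b, B b ->
    ~ (A +s [set m%:Z * k | k in [set k : int | 0 <= k]]) b }.

Definition arises_as_MAC (C : set int) : Prop :=
  exists W : set int, C +s W = [set: int] /\
    forall C' : set int, C' `<` C -> C' +s W <> [set: int].

(* Main.v *)
(** For a minimal complement [W], let [Ym] (resp. [Yp]) be the classes modulo [m]
    in which [W] is unbounded below (resp. above), and [Y0] the classes in which
    it is nonempty and bounded. Since [C] is bounded below, very negative
    integers are only reached through [Ym], which gives (1) together with the
    symmetric argument at +oo. By minimality every [c] in [C] has a [w] in [W]
    such that [c + w] is reached through [c] only. A class in [A + Ym] is
    reached through infinitely many elements of [C], whence (3); for [c] large in
    the class of [a], no class in [A + Yp] or [(A \ a) + Y0] can contain [c + w]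
    either, whence (2). *)
Require Import Defs.
From HB Require Import structures.
From mathcomp Require Import all_boot all_order all_algebra.
From mathcomp Require Import boolp classical_sets functions cardinality.
From mathcomp Require Import zify.
Set Implicit Arguments.
Unset Strict Implicit.
Unset Printing Implicit Defensive.
Import Order.TTheory GRing.Theory Num.Theory.
Local Open Scope classical_set_scope.
Local Open Scope ring_scope.

(** Each [P i] persists upwards from its threshold, and the sum of the absolute values of the
    thresholds dominates every one of them. This turns bounds for single residue classes into one
    bound for all. *)
Lemma fin_uniform_threshold (I : finType) (P : I -> int -> Prop) :
  (forall i, exists N, forall M, N <= M -> P i M) ->
  exists N, forall i, P i N.
Proof.
move=> /choice[f fP]; exists (\sum_i `|f i|) => i; apply: (fP i).
rewrite (bigD1 i) //= (le_trans (ler_norm _)) // lerDl.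
by apply: sumr_ge0 => j _.
Qed.

Lemma finite_set_int_bounded (S : set int) : finite_set S ->
  exists N : int, forall s, S s -> `|s| <= N.
Proof.
move=> /finite_seqP[s ->]; exists (\sum_(x <- s) `|x|) => x /= xs.
by rewrite (big_rem x) //= lerDl; apply: sumr_ge0.
Qed.

Section Projection.
Variables (m : nat) (m_gt0 : (0 < m)%N).

Lemma proj_addM (z k : int) : proj m (z + m%:Z * k) = proj m z.
Proof. by apply/projP => //; rewrite addrC mulrC modzMDl. Qed.

Lemma proj_eq_addM (z w : int) :
  proj m z = proj m w -> exists k, z = w + m%:Z * k.
Proof.
move=> /projP-/(_ m_gt0)/eqP; rewrite eqz_mod_dvd => /dvdzP[k e].
by exists k; rewrite mulrC -e addrC subrK.
Qed.

Lemma proj_ge (x : Zmod m) (N : int) : exists2 n, N <= n & proj m n = x.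
Proof.
exists (x%:Z + m%:Z * `|N|); first by nia.
rewrite proj_addM; apply: val_inj => /=; have := ltn_ord x.
rewrite modz_nat absz_nat => xm.
by rewrite !modn_small //; lia.
Qed.

Lemma proj_le (x : Zmod m) (N : int) : exists2 n, n <= N & proj m n = x.
Proof.
have [n _ nx] := proj_ge x 0.
exists (n + m%:Z * - (`|n| + `|N|)); first by nia.
by rewrite proj_addM.
Qed.

End Projection.

Section EventuallyPeriodic.
Variables (m : nat) (A B F : set int).
Hypotheses (rep : ep_rep m A B F) (A_inj : {in A &, injective (proj m)}).
Let C := epset m A B F.
Let m_gt0 : (0 < m)%N := ep_m_gt0 rep.

Lemma inj_proj_finite : finite_set A.
Proof. by rewrite -(eq_finite_set (inj_card_eq A_inj)); exact: finite_finset. Qed.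

Lemma epset_lbound : exists L : int, forall c, C c -> L <= c.
Proof.
have [NA hA] := finite_set_int_bounded inj_proj_finite.
have [NB hB] := finite_set_int_bounded (ep_B_fin rep).
have [NF hF] := finite_set_int_bounded (ep_F_fin rep).
exists (- (`|NA| + `|NB| + `|NF|)) => c.
by case=> [[[_ [k /= k0 <-] [a /hA ha <-]]|/hB]|/hF]; nia.
Qed.

Lemma epset_class c : C c -> red m A (proj m c) \/ F c.
Proof.
case=> [[[_ [k _ <-] [a Aa <-]]|Bc]|]; last by right.
- by left; exists a => //; rewrite addrC proj_addM.
- by left; apply: (ep_BA rep); exists c.
Qed.

Lemma epset_contains_large : exists T : int,
  forall z, T <= z -> red m A (proj m z) -> C z.
Proof.
have [N hN] := finite_set_int_bounded inj_proj_finite.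
(* Here [a <= N < z], so [z = a + m k] forces [k > 0], as [epset] demands. *)
exists (N + 1) => z Nz [a Aa /esym/(proj_eq_addM m_gt0)[k zE]].
left; left; exists (m%:Z * k); last by exists a => //; rewrite addrC.
by exists k => //=; have := hN a Aa; nia.
Qed.

Section Complement.
Variables (W : set int) (CW : C +s W = [set: int]).

Definition classes_unbounded_below : set (Zmod m) :=
  [set y | forall N : int, exists w, [/\ W w, proj m w = y & w <= N]].
Definition classes_unbounded_above : set (Zmod m) :=
  [set y | forall N : int, exists w, [/\ W w, proj m w = y & N <= w]].
Definition classes_bounded : set (Zmod m) :=
  red m W `\` (classes_unbounded_above `|` classes_unbounded_below).

Local Notation Ym := classes_unbounded_below.
Local Notation Yp := classes_unbounded_above.
Local Notation Y0 := classes_bounded.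

Lemma classes_cover : Yp `|` Ym `|` Y0 = red m W.
Proof.
apply/seteqP; split=> y.
  by case=> [[/(_ 0)|/(_ 0)] [w [Ww wy _]]|[]] //; exists w.
by move=> Wy; have [?|?] := pselect ((Yp `|` Ym) y); [left|right].
Qed.

Lemma lbound_outside_Ym : exists L : int,
  forall w, W w -> ~ Ym (proj m w) -> L <= w.
Proof.
(* Writing the lower bound as [- N] makes the condition weaker as [N] grows. *)
have [|N hN] := @fin_uniform_threshold (Zmod m)
  (fun y N => ~ Ym y -> forall w, W w -> proj m w = y -> - N <= w).
  move=> y; have [Yy|/existsNP[N hN]] := pselect (Ym y); first by exists 0.
  exists (- N) => M NM _ w Ww wy; rewrite leNgt; apply/negP => wM.
  by apply: hN; exists w; split => //; lia.
by exists (- N) => w Ww /hN; apply.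
Qed.

Lemma ubound_outside_Yp : exists U : int,
  forall w, W w -> ~ Yp (proj m w) -> w <= U.
Proof.
have [|N hN] := @fin_uniform_threshold (Zmod m)
  (fun y N => ~ Yp y -> forall w, W w -> proj m w = y -> w <= N).
  move=> y; have [Yy|/existsNP[N hN]] := pselect (Yp y); first by exists 0.
  exists N => M NM _ w Ww wy; rewrite leNgt; apply/negP => wM.
  by apply: hN; exists w; split => //; lia.
by exists N => w Ww /hN; apply.
Qed.

(** The bound [U] is fixed before any element of [C] is chosen. A sufficiently large [c] then lets
    both [w1] and [w2] compete with the witness of [c], and they cannot both equal it. *)
Lemma Yp_two_elements : exists U : int, forall y, Yp y ->
  exists w1 w2, [/\ W w1 /\ proj m w1 = y, W w2 /\ proj m w2 = y,
                    w1 < w2 & w2 <= U].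
Proof.
apply: (@fin_uniform_threshold (Zmod m)) => y.
have [Yy|Yy] := pselect (Yp y); last by exists 0.
have [w1 [Ww1 w1y _]] := Yy 0.
have [w2 [Ww2 w2y w12]] := Yy (w1 + 1).
by exists w2 => M w2M _; exists w1, w2; split => //; lia.
Qed.

Lemma complement_cover_below : (red m A `|` red m F) +s Ym = [set: Zmod m].
Proof.
apply/seteqP; split=> // x _.
have [L hL] := epset_lbound; have [L' hL'] := lbound_outside_Ym.
(* Any [c + w] with the class of [w] outside [Ym] is at least [L + L'], hence exceeds [n]. *)
have [n nL nx] := proj_le m_gt0 x (L + L' - 1).
have : (C +s W) n by rewrite CW.
case=> c Cc [w Ww cwn]; exists (proj m c).
  by have [|Fc] := epset_class Cc; [left|right; exists c].
exists (proj m w); last by rewrite -projD // cwn.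
apply: contrapT => /(hL' _ Ww); have := hL _ Cc; lia.
Qed.

(** Only [F] is bounded above: a large [n] reached through [F] needs a large [w], whose class is in
    [Yp], while one reached through a class of [A] puts no constraint on [w]. *)
Lemma complement_cover_above :
  (red m A +s red m W) `|` (red m F +s Yp) = [set: Zmod m].
Proof.
apply/seteqP; split=> // x _.
have [U hU] := finite_set_int_bounded (ep_F_fin rep).
have [U' hU'] := ubound_outside_Yp.
have [n nU nx] := proj_ge m_gt0 x (U + U' + 1).
have : (C +s W) n by rewrite CW.
case=> c Cc [w Ww cwn].
have [Ac|Fc] := epset_class Cc; [left|right]; exists (proj m c) => //.
- by exists (proj m w); [exists w|rewrite -projD // cwn].
- by exists c.
exists (proj m w); last by rewrite -projD // cwn.
apply: contrapT => /(hU' _ Ww); have := hU _ Fc; lia.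
Qed.

(** Taking [w] very negative in its class makes [n - w] large in a class of [A], hence an element of
    [C]. *)
Lemma AYm_large_representation n N : (red m A +s Ym) (proj m n) ->
  exists c w, [/\ C c, W w, red m A (proj m c), N <= c & c + w = n].
Proof.
move=> [a Aa [y Yy ayn]]; have [T hT] := epset_contains_large.
have [w [Ww wy wN]] := Yy (n - `|N| - `|T|).
have cA : red m A (proj m (n - w)).
  suff -> : proj m (n - w) = a by [].
  by apply: (addIr y); rewrite ayn -wy -projD // subrK.
exists (n - w), w; split => //; [apply: hT => //|..]; lia.
Qed.

Hypothesis W_min : forall C' : set int, C' `<` C -> C' +s W <> [set: int].

Lemma unique_witness c : C c -> exists2 w, W w &
  forall c' w', C c' -> W w' -> c' + w' = c + w -> c' = c.
Proof.
move=> Cc; have : C `\ c +s W <> [set: int].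
  apply: W_min; split=> [x []//|/(_ _ Cc)[_]]; exact.
move=> /seteqP/not_andP[|]; first by case=> x.
move=> /existsNP[n /not_implyP[_ nW]].
have : (C +s W) n by rewrite CW.
case=> c1 Cc1 [w Ww n_eq].
have uniq c' w' : C c' -> W w' -> c' + w' = n -> c' = c.
  move=> Cc' Ww' e; apply: contrapT => c'c; apply: nW.
  by exists c' => //; exists w'.
have c1c := uniq _ _ Cc1 Ww n_eq.
exists w => // c' w' Cc' Ww' e.
by apply: (uniq _ _ Cc' Ww'); rewrite e -c1c.
Qed.

Lemma F_class_witness f : red m F f ->
  exists2 y, red m W y & ~ (red m A +s Ym) (f + y).
Proof.
move=> [f' Ff <-{f}]; have [|w Ww uniq] := @unique_witness f'; first by right.
exists (proj m w); first by exists w.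
rewrite -projD // => /(AYm_large_representation 0)[c [w' [Cc Ww' Ac _ e]]].
have cf := uniq _ _ Cc Ww' e.
have : (red m F `&` red m A) (proj m f') by split; [exists f'|rewrite -cf].
by rewrite (ep_FA rep).
Qed.

Lemma A_class_witness a : red m A a -> exists2 y, Y0 y &
  ((red m F +s Ym) `\`
    (((red m A `\ a) +s Y0) `|` (red m A +s (Ym `|` Yp)))) (a + y).
Proof.
move=> Aa; have [T hT] := epset_contains_large.
have [L hL] := lbound_outside_Ym; have [U hU] := ubound_outside_Yp.
have [V hV] := Yp_two_elements.
(* For [w >= L] and [w' <= |U| + |V|] this gives [c + w - w' >= |T|], so that [c + w - w'] is in [C]
   once its class is in [A]. *)
have [c c_ge ca] := proj_ge m_gt0 a (`|T| + `|L| + `|U| + `|V|).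
have Cc : C c by apply: hT; [lia|rewrite ca].
have [w Ww uniq] := unique_witness Cc.
pose y := proj m w.
have cwE : proj m (c + w) = a + y by rewrite projD // ca.
have nAYm : ~ (red m A +s Ym) (a + y).
  (* The bound [c + 1] produces a representation through some [c' > c], against uniqueness. *)
  rewrite -cwE => /(AYm_large_representation (c + 1)).
  by move=> [c' [w' [Cc' Ww' _ c'_ge /(uniq _ _ Cc' Ww')]]]; lia.
have nYm : ~ Ym y by move=> Yy; apply: nAYm; exists a => //; exists y.
have wL := hL _ Ww nYm.
have subE a' w' : a' + proj m w' = a + y -> proj m (c + w - w') = a'.
  by move=> e; apply: (addIr (proj m w')); rewrite -projD // subrK cwE e.
have single a' w' : red m A a' -> W w' -> w' <= `|U| + `|V| ->
    a' + proj m w' = a + y -> w' = w.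
  move=> Aa' Ww' w'_le /subE e.
  suff : c + w - w' = c by lia.
  apply: (uniq _ w') => //; last by rewrite subrK.
  by apply: hT; [lia|rewrite e].
have nAYp : ~ (red m A +s Yp) (a + y).
  move=> [a' Aa' [y' /hV[w1 [w2 [[Ww1 w1y] [Ww2 w2y] w12 w2V]]] e]].
  have e1 : w1 = w by apply: (single a') => //; [lia|rewrite w1y].
  have e2 : w2 = w by apply: (single a') => //; [lia|rewrite w2y].
  by lia.
have nYp : ~ Yp y by move=> Yy; apply: nAYp; exists a => //; exists y.
exists y; first by split; [exists w|case].
split.
  (* As [A + Ym] is excluded, the covering by [Ym] leaves only [F + Ym]. *)
  have : ((red m A `|` red m F) +s Ym) (a + y) by rewrite complement_cover_below.
  case=> x [Ax|Fx] [z Yz e]; last by exists x => //; exists z.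
  by case: nAYm; exists x => //; exists z.
case=> [[a' [Aa' a'a] [_ [[w' Ww' <-] nY] e]]|[a' Aa' [y' [Yy|Yy] e]]].
(* A class of [Y0] is outside [Yp], so [w' <= U] and [single] applies; cancelling the class of [w]
   then gives [a' = a]. *)
- have w'w : w' = w.
    apply: (single a') => //.
    suff: w' <= U by lia.
    by apply: hU => // ?; apply: nY; left.
  by apply: a'a; rewrite w'w in e; apply: addIr e.
- by apply: nAYm; exists a' => //; exists y'.
- by apply: nAYp; exists a' => //; exists y'.
Qed.

End Complement.
End EventuallyPeriodic.

Theorem theorem5 (m : nat) (A B F C : set int)
  (hrep : normalized_ep_rep m A B F) (hC : C = epset m A B F)
  (hmac : arises_as_MAC C) :
  exists Yp Ym Y0 : set (Zmod m), let Y := Yp `|` Ym `|` Y0 in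
  [/\ (red m A +s Y) `|` (red m F +s Yp) = (red m A `|` red m F) +s Ym
        /\ (red m A `|` red m F) +s Ym = [set: Zmod m],
      forall a, red m A a -> exists2 ya, Y0 ya &
        ((red m F +s Ym) `\`
          (((red m A `\ a) +s Y0) `|` (red m A +s (Ym `|` Yp)))) (a + ya) &
      forall f, red m F f -> exists2 y, Y y & ~ (red m A +s Ym) (f + y)].
Proof.
have [W [CW W_min]] := hmac; have [rep _ A_inj _] := hrep; subst C.
exists (classes_unbounded_above W), (classes_unbounded_below W).
exists (classes_bounded W) => Y.
have YE : Y = red m W by apply: classes_cover.
have below := complement_cover_below rep A_inj CW.
split; first by rewrite YE below; split=> //; exact: (complement_cover_above rep CW).
- exact: (A_class_witness rep A_inj CW W_min).
- by rewrite YE; apply: (F_class_witness rep A_inj CW W_min).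
Qed.
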